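(* Let $n,d\ge 1$, let $f_1,\dots,f_n:\mathbb{R}^d\to\mathbb{R}$ be differentiable and $L$-smooth ($L>0$), let $f=\frac1n\sum_{i=1}^n f_i$ be $\mu$-strongly convex ($\mu>0$), and let $x^*$ be the minimizer of $f$. Run the L-SVRG method with stepsize $\eta=\frac1{6L}$ and probability $p\in(0,1]$ from any $x^0=w^0\in\mathbb{R}^d$, and let $$\Phi^k=\|x^k-x^*\|^2+\frac{4\eta^2}{pn}\sum_{i=1}^n\|\nabla f_i(w^k)-\nabla f_i(x^* )\|^2 .$$ The method calls the stochastic gradient oracle $\mathcal O(1+pn)$ times per iteration in expectation, and its total complexity (expected number of stochastic gradient calls needed to reach $\mathbb{E}[\Phi^k]\le\varepsilon\,\Phi^0$, unconditional expectation) is $$\mathcal O\left(\left(\frac1p+n+\frac L\mu+\frac{Lpn}{\mu}\right)\log\frac1\varepsilon\right).$$ Consequently, any choice of $p$ with $$\min\left\{\frac cn,\frac{c\mu}{L}\right\}\le p\le\max\left\{\frac cn,\frac{c\mu}{L}\right\},\qquad c=\Theta(1),$$ leads to the total complexity $\mathcal O\left(\left(n+\frac L\mu\right)\log\frac1\varepsilon\right)$.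
   Context: $\|\cdot\|$ and $\langle\cdot,\cdot\rangle$ are the Euclidean norm and inner product on $\mathbb{R}^d$. The constants in $\mathcal O(\cdot)$ are absolute, except that in the final bound the constant may depend on the constant $c$. A differentiable function $h$ is $L$-smooth if $h(y)\le h(x)+\langle\nabla h(x),y-x\rangle+\frac L2\|y-x\|^2$ for all $x,y\in\mathbb{R}^d$, and $\mu$-strongly convex if $h(y)\ge h(x)+\langle\nabla h(x),y-x\rangle+\frac\mu2\|y-x\|^2$ for all $x,y\in\mathbb{R}^d$. L-SVRG with stepsize $\eta>0$ and probability $p\in(0,1]$: start from deterministic $x^0=w^0\in\mathbb{R}^d$. For $k=0,1,2,\dots$: sample $i$ uniformly at random from $\{1,\dots,n\}$; set $g^k=\nabla f_i(x^k)-\nabla f_i(w^k)+\nabla f(w^k)$; set $x^{k+1}=x^k-\eta g^k$; set $w^{k+1}=x^k$ with probability $p$ and $w^{k+1}=w^k$ with probability $1-p$. All random draws (indices and coin flips) are mutually independent. One stochastic gradient call is one evaluation of some $\nabla f_i$ at a point; a full gradient $\nabla f$ costs $n$ calls and is recomputed only when the reference point $w^k$ is updated. The final total complexity is described by the authors as optimal.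
   Formalization: Each f_i is additionally assumed convex: without this the complexity claim fails (e.g. n=2, f_1=x²/2, f_2=-(1-2μ)x²/2 with μ=1/1000, p=1/100). The O(... log(1/ε)) bounds are stated for 0<ε≤1/2. *)

(* Defs.v *)
From HB Require Import structures.
From mathcomp Require Import all_boot all_order all_algebra.
From mathcomp Require Import all_classical all_reals all_analysis.

Set Implicit Arguments.
Unset Strict Implicit.
Unset Printing Implicit Defensive.
Import Order.TTheory GRing.Theory Num.Theory.
Import numFieldNormedType.Exports.

Local Open Scope classical_set_scope.
Local Open Scope ring_scope.

Section Euclidean.
Context {R : realType} {d : nat}.
Implicit Types (x y : 'rV[R]_d) (h : 'rV[R]_d -> R).

(* The library norm `|x| on 'rV[R]_d is the sup norm, hence these two. *)
Definition inner x y : R := \sum_(j < d) x 0 j * y 0 j.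
Definition enorm x : R := Num.sqrt (inner x x).

Definition grad h x : 'rV[R]_d := \row_j 'D_(delta_mx 0 j) h x.

(* The predicates below only bound h; differentiability is always assumed
   separately. *)
Definition smooth (L : R) h := forall x y,
  h y <= h x + inner (grad h x) (y - x) + L / 2 * enorm (y - x) ^+ 2.

Definition strongly_convex (mu : R) h := forall x y,
  h y >= h x + inner (grad h x) (y - x) + mu / 2 * enorm (y - x) ^+ 2.

(* Convexity of a differentiable function, i.e. the case mu = 0 above. *)
Definition convex_diff h := forall x y,
  h y >= h x + inner (grad h x) (y - x).

Definition average {n : nat} (f : 'I_n -> 'rV[R]_d -> R) x : R :=
  n%:R^-1 * \sum_(i < n) f i x.

End Euclidean.

Section LSVRG.
Context {R : realType} {n d : nat}.
Variables (f : 'I_n -> 'rV[R]_d -> R) (eta : R).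

(* [calls] is the number of stochastic gradient calls made so far. *)
Record lsvrg_state := LSVRGState {
  iterate : 'rV[R]_d ;
  reference : 'rV[R]_d ;
  calls : nat }.

(* The full gradient at the initial reference point costs n calls. *)
Definition lsvrg_init (x0 : 'rV[R]_d) := LSVRGState x0 x0 n.

(* One iteration evaluates grad (f i) at the iterate and at the reference point
   (2 calls); the full gradient at the reference point is stored, and its
   recomputation (n calls) is charged exactly when the coin b updates it. *)
Definition lsvrg_step (i : 'I_n) (b : bool) (s : lsvrg_state) :=
  let g := grad (f i) (iterate s) - grad (f i) (reference s)
           + grad (average f) (reference s) in
  LSVRGState (iterate s - eta *: g)
             (if b then iterate s else reference s)
             (calls s + 2 + (if b then n else 0)).

Fixpoint lsvrg (x0 : 'rV[R]_d) (idx : nat -> 'I_n) (coin : nat -> bool)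
    (k : nat) : lsvrg_state :=
  if k is k'.+1 then lsvrg_step (idx k') (coin k') (lsvrg x0 idx coin k')
  else lsvrg_init x0.

Definition potential (p : R) (xs : 'rV[R]_d) (s : lsvrg_state) : R :=
  enorm (iterate s - xs) ^+ 2
  + 4 * eta ^+ 2 / (p * n%:R)
    * \sum_(i < n) enorm (grad (f i) (reference s) - grad (f i) xs) ^+ 2.

End LSVRG.

Section Draws.
Context {disp : measure_display} {T : measurableType disp} {R : realType}.
Variable P : probability T R.

(* Mutual independence of a family of classes of events: product rule over
   every finite subfamily. *)
Definition mutually_independent (J : eqType) (E : J -> set (set T)) :=
  forall (s : seq J) (A : J -> set T), uniq s ->
    (forall j, j \in s -> E j (A j)) ->
    P (\bigcap_(j in [set` s]) A j) = (\prod_(j <- s) P (A j))%E.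

(* The sigma-algebra generated by a random variable with values in a discrete
   space. *)
Definition events_of (S : Type) (X : T -> S) : set (set T) :=
  [set X @^-1` B | B in [set: set S]].

Definition draw_events (n : nat) (idx : nat -> T -> 'I_n)
    (coin : nat -> T -> bool) (j : nat + nat) : set (set T) :=
  match j with
  | inl k => events_of (idx k)
  | inr k => events_of (coin k)
  end.

Record lsvrg_draws (n : nat) (p : R) (idx : nat -> T -> 'I_n)
    (coin : nat -> T -> bool) : Prop := LSVRGDraws {
  idx_measurable : forall k, events_of (idx k) `<=` measurable ;
  coin_measurable : forall k, events_of (coin k) `<=` measurable ;
  idx_uniform : forall k i, P (idx k @^-1` [set i]) = (n%:R^-1)%:E ;
  coin_bernoulli : forall k, P (coin k @^-1` [set true]) = p%:E ;
  draws_independent : mutually_independent (draw_events idx coin) }.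

(* k is the first iteration at which the expectation of the process X is at
   most t. *)
Definition first_reaches (X : nat -> T -> R) (t : R) (k : nat) : Prop :=
  ('E_P[X k] <= t%:E)%E /\ forall j, (j < k)%N -> (t%:E < 'E_P[X j])%E.

End Draws.

(* Main.v *)
Require Import Defs.
From HB Require Import structures.
From mathcomp Require Import all_boot all_order all_algebra.
From mathcomp Require Import all_classical all_reals all_analysis.
From mathcomp Require Import measurable_realfun ring lra.
Import Order.TTheory GRing.Theory Num.Theory.
Import numFieldNormedType.Exports.
Set Implicit Arguments.
Unset Strict Implicit.
Unset Printing Implicit Defensive.
Local Open Scope classical_set_scope.
Local Open Scope ring_scope.

(* In one step the conditional mean of the potential contracts by the factor
   1 - rho with rho = min (mu eta) (p / 2): cocoercivity of the gradients bounds
   the second moment of the search direction by the function gap plus the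
   gradient distance at the reference point, and both are absorbed by the two
   terms of the potential.  Independence of the draws turns this into
   E Phi^k <= (1 - rho)^k Phi^0, so that 1 + ln (1 / eps) / rho iterations
   suffice, where 1 / rho <= 6 L / mu + 2 / p.  The expected number of calls
   after k iterations is exactly n + k (2 + p n). *)

(** * Euclidean inner product and the variance inequality *)

Section InnerProduct.
Context {R : realType} {d : nat}.
Implicit Types (x y z v : 'rV[R]_d) (c : R).

Lemma innerC x y : inner x y = inner y x.
Proof. by apply: eq_bigr => j _; rewrite mulrC. Qed.

Lemma innerDl x y z : inner (x + y) z = inner x z + inner y z.
Proof.
by rewrite /inner -big_split; apply: eq_bigr => j _; rewrite !mxE mulrDl.
Qed.

Lemma innerZl c x y : inner (c *: x) y = c * inner x y.
Proof.
by rewrite /inner mulr_sumr; apply: eq_bigr => j _; rewrite !mxE mulrA.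
Qed.

Lemma inner0l x : inner 0 x = 0.
Proof. by rewrite -(scale0r 0) innerZl mul0r. Qed.

Lemma innerNl x y : inner (- x) y = - inner x y.
Proof. by rewrite -scaleN1r innerZl mulN1r. Qed.

Lemma innerDr x y z : inner x (y + z) = inner x y + inner x z.
Proof. by rewrite innerC innerDl !(innerC x). Qed.

Lemma innerZr c x y : inner x (c *: y) = c * inner x y.
Proof. by rewrite innerC innerZl (innerC x). Qed.

Lemma innerNr x y : inner x (- y) = - inner x y.
Proof. by rewrite innerC innerNl (innerC x). Qed.

Lemma inner_suml (n : nat) (F : 'I_n -> 'rV[R]_d) y :
  inner (\sum_i F i) y = \sum_i inner (F i) y.
Proof.
rewrite /inner exchange_big; apply: eq_bigr => j _.
by rewrite summxE mulr_suml.
Qed.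

Lemma inner_ge0 x : 0 <= inner x x.
Proof. by apply: sumr_ge0 => j _; rewrite -expr2 sqr_ge0. Qed.

Lemma inner_eq0 x : inner x x <= 0 -> x = 0.
Proof.
move=> x_le0; have /eqP : inner x x == 0 by rewrite eq_le x_le0 inner_ge0.
move/psumr_eq0P => x0; apply/rowP => j; rewrite mxE.
have /eqP : x 0 j * x 0 j = 0.
  by apply: x0 => // i _; rewrite -expr2 sqr_ge0.
by rewrite mulf_eq0 orbb => /eqP.
Qed.

Lemma enorm_sqr x : enorm x ^+ 2 = inner x x.
Proof. by rewrite sqr_sqrtr ?inner_ge0. Qed.

Definition innerE := (innerDl, innerDr, innerNl, innerNr, innerZl, innerZr).

Lemma enorm_sqrB_le x y :
  enorm (x - y) ^+ 2 <= 2 * enorm x ^+ 2 + 2 * enorm y ^+ 2.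
Proof.
have := inner_ge0 (x + y); rewrite !enorm_sqr !innerE (innerC y x).
lra.
Qed.

(** A variance is at most a second moment: expanding the squares around the mean [m] removes exactly
    [n * inner m m] from the sum. *)
Lemma sum_enorm_sqr_centered_le (n : nat) (F : 'I_n -> 'rV[R]_d) :
  \sum_i enorm (F i - n%:R^-1 *: \sum_j F j) ^+ 2 <= \sum_i enorm (F i) ^+ 2.
Proof.
case: n F => [|n] F; first by rewrite !big_ord0.
set m := _ *: _.
have sumF : \sum_i F i = n.+1%:R *: m.
  by rewrite scalerA mulfV ?pnatr_eq0// scale1r.
clearbody m.
have sumFm : \sum_i inner (F i) m = n.+1%:R * inner m m.
  by rewrite -inner_suml sumF innerZl.
have -> : \sum_i enorm (F i - m) ^+ 2 =
    \sum_i enorm (F i) ^+ 2 - n.+1%:R * inner m m.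
  transitivity (\sum_i (enorm (F i) ^+ 2 - 2 * inner (F i) m + inner m m)).
    apply: eq_bigr => i _; rewrite !enorm_sqr !innerE (innerC m); lra.
  rewrite !big_split/= sumrN -mulr_sumr sumFm sumr_const card_ord -mulr_natl.
  lra.
by rewrite gerBl mulr_ge0 ?inner_ge0.
Qed.

End InnerProduct.

(** * Gradients of averages, smoothness and convexity *)

Section SmoothConvex.
Context {R : realType} {d : nat}.
Implicit Types (h : 'rV[R]_d -> R) (x y : 'rV[R]_d).

Lemma grad_average (n : nat) (f : 'I_n -> 'rV[R]_d -> R) x :
  (forall i, differentiable (f i) x) ->
  grad (average f) x = n%:R^-1 *: \sum_i grad (f i) x.
Proof.
move=> df; apply/rowP => j; rewrite !mxE summxE.
have fE : average f = n%:R^-1 \*: (\sum_i f i).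
  by apply/funext => y; rewrite /average/= fct_sumE.
rewrite fE deriveZ; last first.
  by apply: derivable_sum => i; exact: diff_derivable.
rewrite derive_sum; last by move=> i; exact: diff_derivable.
by congr (_ * _); apply: eq_bigr => i _; rewrite mxE.
Qed.

(* Comparing [h] with its linearisation at [y] and with the quadratic upper
   bound at [x], both taken at the gradient step [x - (grad h x - grad h y) / L]. *)
Lemma smooth_convex_grad_le (L : R) h x y : 0 < L ->
  smooth L h -> convex_diff h ->
  enorm (grad h x - grad h y) ^+ 2
    <= 2 * L * (h x - h y - inner (grad h y) (x - y)).
Proof.
move=> L0 hL hc; set g := grad h x - grad h y.
have gxE : grad h x = g + grad h y by rewrite subrK.
clearbody g.
have zxE : x - L^-1 *: g - x = - (L^-1 *: g) by rewrite addrAC subrr add0r.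
have := hc y (x - L^-1 *: g); have := hL x (x - L^-1 *: g).
rewrite zxE gxE !enorm_sqr !innerE.
set G := inner g g; set a := inner _ g; set b := inner _ x; set c := inner _ y.
have -> : L / 2 * - - (L^-1 * (L^-1 * G)) = L^-1 * G / 2.
  by field; rewrite gt_eqF.
(* With [G = L * u], cancelling [L] leaves a goal linear in [u]. *)
set u := L^-1 * G; have -> : G = L * u by rewrite /u mulrA mulfV ?mul1r ?gt_eqF.
move: (L^-1 * a) => t; rewrite ?opprK.
move=> H1 H2; rewrite -mulrA [2 * (L * _)]mulrCA ler_pM2l//. lra.
Qed.

(** A gradient step of length [1 / L] lowers [h] by at least [G / (2 L)], with [G] the squared norm
    of the gradient; at a minimizer this forces [G <= 0]. *)
Lemma smooth_min_grad0 (L : R) h x : 0 < L -> smooth L h ->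
  (forall y, h x <= h y) -> grad h x = 0.
Proof.
move=> L0 hL hmin; apply: inner_eq0.
have := hL x (x - L^-1 *: grad h x); have := hmin (x - L^-1 *: grad h x).
have -> : x - L^-1 *: grad h x - x = - (L^-1 *: grad h x).
  by rewrite addrAC subrr add0r.
rewrite enorm_sqr !innerE.
set G := inner _ _.
have -> : L / 2 * - - (L^-1 * (L^-1 * G)) = L^-1 * G / 2.
  by field; rewrite gt_eqF.
move=> H1 H2; have : L^-1 * G <= 0 by lra.
by rewrite pmulr_rle0 ?invr_gt0.
Qed.

Lemma smooth_average (n : nat) (f : 'I_n -> 'rV[R]_d -> R) (L : R) :
  (0 < n)%N -> (forall i x, differentiable (f i) x) ->
  (forall i, smooth L (f i)) -> smooth L (average f).
Proof.
move=> n0 df fL x y; rewrite grad_average// /average innerZl inner_suml.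
set q := L / 2 * _.
have -> : q = n%:R^-1 * \sum_(i < n) q.
  by rewrite sumr_const card_ord -[q *+ n]mulr_natl mulKf// pnatr_eq0 -lt0n.
rewrite -!mulrDr -!big_split/= ler_pM2l ?invr_gt0 ?ltr0n//.
by apply: ler_sum => i _; exact: fL.
Qed.

End SmoothConvex.

(** * The Markov operator of one iteration and its powers *)

Section Mean.
Context {R : realType} {n d : nat}.
Variables (f : 'I_n -> 'rV[R]_d -> R) (eta p : R).
Implicit Types (F G : lsvrg_state (R := R) (d := d) -> R).
Implicit Types (s : lsvrg_state (R := R) (d := d)).

(** The conditional expectation of [F] after one iteration started at [s], as a finite sum, free of
    any probability space. *)
Definition lsvrg_mean_step F s : R :=
  n%:R^-1 * \sum_(i < n)
    (p * F (lsvrg_step f eta i true s) + (1 - p) * F (lsvrg_step f eta i false s)).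

(** Each new step is applied to the observable [F], so unfolding the recursion exposes the last
    iteration, as in [lsvrg]. *)
Fixpoint lsvrg_mean k F s : R :=
  if k is k'.+1 then lsvrg_mean k' (lsvrg_mean_step F) s else F s.

Lemma average_cst (q : R) : (0 < n)%N -> n%:R^-1 * \sum_(i < n) q = q.
Proof.
move=> n0; rewrite sumr_const card_ord -[q *+ n]mulr_natl.
by rewrite mulKf// pnatr_eq0 -lt0n.
Qed.

Lemma average_shift (a : 'I_n -> R) (q : R) : (0 < n)%N ->
  n%:R^-1 * \sum_i (a i + q) = n%:R^-1 * \sum_i a i + q.
Proof. by move=> n0; rewrite big_split/= mulrDr average_cst. Qed.

Lemma lsvrg_meanZ k F s (c : R) :
  lsvrg_mean k (fun t => c * F t) s = c * lsvrg_mean k F s.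
Proof.
elim: k F => //= k IH F; rewrite -IH; congr (lsvrg_mean k _ s).
apply/funext => t; rewrite /lsvrg_mean_step [RHS]mulrCA; congr (_ * _).
by rewrite mulr_sumr; apply: eq_bigr => i _; ring.
Qed.

Lemma lsvrg_mean_sum (I : Type) (r : seq I) k (F : I -> _) s :
  lsvrg_mean k (fun t => \sum_(i <- r) F i t) s = \sum_(i <- r) lsvrg_mean k (F i) s.
Proof.
elim: k F => //= k IH F; rewrite -IH; congr (lsvrg_mean k _ s).
apply/funext => t; rewrite /lsvrg_mean_step -mulr_sumr; congr (_ * _).
rewrite [RHS]exchange_big; apply: eq_bigr => i _.
by rewrite !mulr_sumr -big_split.
Qed.

Lemma lsvrg_mean_shift k F s (c : R) : (0 < n)%N ->
  lsvrg_mean k (fun t => F t + c) s = lsvrg_mean k F s + c.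
Proof.
move=> n0; elim: k F => //= k IH F; rewrite -IH; congr (lsvrg_mean k _ s).
apply/funext => t; rewrite /lsvrg_mean_step -average_shift//; congr (_ * _).
by apply: eq_bigr => i _; ring.
Qed.

Lemma le_lsvrg_mean k F G s : 0 <= p <= 1 -> (forall t, F t <= G t) ->
  lsvrg_mean k F s <= lsvrg_mean k G s.
Proof.
move=> /andP[p0 p1]; elim: k F G => //= k IH F G FG; apply: IH => t.
rewrite ler_wpM2l ?invr_ge0 ?ler0n//; apply: ler_sum => i _.
by rewrite lerD// ler_wpM2l// subr_ge0.
Qed.

(** The one-step bound holds at every state, so the monotone and homogeneous operator can be applied
    to it repeatedly. *)
Lemma lsvrg_mean_geometric k F s (q : R) : 0 <= p <= 1 -> 0 <= q ->
  (forall t, lsvrg_mean_step F t <= q * F t) ->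
  lsvrg_mean k F s <= q ^+ k * F s.
Proof.
move=> p01 q0 Fq; elim: k => [|k IH]; first by rewrite mul1r.
rewrite exprS -mulrA (le_trans (le_lsvrg_mean k s p01 Fq))//.
by rewrite lsvrg_meanZ ler_wpM2l.
Qed.

Lemma lsvrg_mean_calls k s : (0 < n)%N ->
  lsvrg_mean k (fun t => (calls t)%:R) s = (calls s)%:R + k%:R * (2 + p * n%:R).
Proof.
move=> n0; elim: k => [|k IH] /=; first by rewrite mul0r addr0.
have -> : lsvrg_mean_step (fun t => (calls t)%:R) =
    fun t => (calls t)%:R + (2 + p * n%:R).
  apply/funext => t; rewrite /lsvrg_mean_step/= addn0.
  rewrite -[RHS](average_cst _ n0); congr (_ * _).
  by apply: eq_bigr => i _; rewrite !natrD; ring.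
by rewrite lsvrg_mean_shift// IH -natr1; ring.
Qed.

End Mean.

(* The stepsize enters through [6 L eta = 1]: the terms in the function gap
   then cancel exactly, as [- 2 eta + 2 * 2 L eta^2 + 4 * 2 L eta^2 = 0]. *)
Lemma descent_arith {R : realFieldType} (L mu p eta rho A D a b q v dl : R) :
  0 < eta -> 6 * L * eta = 1 -> 0 <= A -> 0 <= D ->
  p * D = 4 * eta ^+ 2 * b -> rho <= mu * eta -> rho <= p / 2 ->
  q <= 2 * a + 2 * b -> a <= 2 * L * dl -> dl + mu / 2 * A <= v ->
  A - 2 * eta * v + eta ^+ 2 * q + (4 * eta ^+ 2 * a + (1 - p) * D)
    <= (1 - rho) * (A + D).
Proof.
move=> eta_gt0 Leta A0 D0 Dp rho1 rho2 qab adl sc.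
have e2 : 0 <= eta ^+ 2 by exact: sqr_ge0.
have h1 : eta ^+ 2 * q <= eta ^+ 2 * (2 * a + 2 * b) by rewrite ler_wpM2l.
have h2 : eta ^+ 2 * a <= eta ^+ 2 * (2 * L * dl) by rewrite ler_wpM2l.
have h3 : eta * (dl + mu / 2 * A) <= eta * v by rewrite ler_wpM2l// ltW.
have h4 : rho * A <= mu * eta * A by rewrite ler_wpM2r.
have h5 : rho * D <= p / 2 * D by rewrite ler_wpM2r.
have h6 : 6 * (eta ^+ 2 * (2 * L * dl)) = 2 * eta * dl.
  transitivity (2 * eta * dl * (6 * L * eta)); [ring | by rewrite Leta mulr1].
lra.
Qed.

(** * One-step contraction of the potential *)

Section Contraction.
Context {R : realType} {n d : nat}.
Variables (f : 'I_n -> 'rV[R]_d -> R) (L mu p : R) (xs : 'rV[R]_d).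
Hypotheses (n_gt0 : (0 < n)%N) (L_gt0 : 0 < L) (p_gt0 : 0 < p).
Hypothesis f_diff : forall i x, differentiable (f i) x.
Hypothesis f_convex : forall i, convex_diff (f i).
Hypothesis f_smooth : forall i, smooth L (f i).
Hypothesis f_sc : strongly_convex mu (average f).
Hypothesis xs_min : forall y, average f xs <= average f y.

Let eta : R := (6 * L)^-1.
Let delta x : R := average f x - average f xs.
Definition grad_dist x : R :=
  \sum_(i < n) enorm (grad (f i) x - grad (f i) xs) ^+ 2.

Let n_neq0 : n%:R != 0 :> R. Proof. by rewrite pnatr_eq0 -lt0n. Qed.

Lemma sum_grad_min : \sum_i grad (f i) xs = 0.
Proof.
have := smooth_min_grad0 L_gt0 (smooth_average n_gt0 f_diff f_smooth) xs_min.
rewrite grad_average// => /(congr1 (fun v => n%:R *: v)).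
by rewrite scalerA mulfV// scale1r scaler0.
Qed.

(** Cocoercivity summed over the components; the linear terms cancel because the gradients at [xs]
    sum to zero. *)
Lemma grad_dist_le x : n%:R^-1 * grad_dist x <= 2 * L * delta x.
Proof.
rewrite /delta /average -mulrBr mulrCA ler_wpM2l ?invr_ge0 ?ler0n//.
have -> : \sum_(i < n) f i x - \sum_(i < n) f i xs =
    \sum_(i < n) (f i x - f i xs - inner (grad (f i) xs) (x - xs)).
  rewrite !sumrB -inner_suml sum_grad_min.
  by rewrite inner0l subr0.
rewrite mulr_sumr; apply: ler_sum => i _.
exact: smooth_convex_grad_le.
Qed.

(** Inserting [grad (f i) xs] splits the direction into a gradient difference at [x] minus a centred
    gradient difference at [w], whose mean is [grad (average f) w]. The variance inequality then
    drops the centring. *)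
Lemma lsvrg_direction_sqr_le x w :
  n%:R^-1 * \sum_(i < n)
    enorm (grad (f i) x - grad (f i) w + grad (average f) w) ^+ 2 <=
  2 * (n%:R^-1 * grad_dist x) + 2 * (n%:R^-1 * grad_dist w).
Proof.
have factor (c a b : R) : 2 * (c * a) + 2 * (c * b) = c * (2 * a + 2 * b).
  by ring.
rewrite factor ler_wpM2l ?invr_ge0 ?ler0n//.
have -> : grad (average f) w =
    n%:R^-1 *: \sum_i (grad (f i) w - grad (f i) xs).
  by rewrite grad_average// sumrB sum_grad_min subr0.
set b := fun i => grad (f i) w - grad (f i) xs.
apply: (@le_trans _ _ (\sum_(i < n) (2 * enorm (grad (f i) x - grad (f i) xs) ^+ 2
    + 2 * enorm (b i - n%:R^-1 *: \sum_j b j) ^+ 2))); last first.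
  rewrite big_split/= -!mulr_sumr lerD2l ler_pM2l//.
  exact: sum_enorm_sqr_centered_le.
apply: ler_sum => i _; apply: le_trans (enorm_sqrB_le _ _).
rewrite le_eqVlt; apply/orP; left; apply/eqP; congr (enorm _ ^+ 2).
by rewrite opprB addrCA addrC -/(b i) /b; congr (_ + _); rewrite opprB addrA subrK.
Qed.

(** The direction is unbiased: the two corrections at [w] cancel on average, which leaves
    [grad (average f) x] in the cross term. *)
Lemma lsvrg_iterate_mean x w :
  n%:R^-1 * \sum_(i < n)
    enorm (x - eta *: (grad (f i) x - grad (f i) w + grad (average f) w) - xs) ^+ 2
  = enorm (x - xs) ^+ 2 - 2 * eta * inner (grad (average f) x) (x - xs)
    + eta ^+ 2 * (n%:R^-1 * \sum_(i < n)
        enorm (grad (f i) x - grad (f i) w + grad (average f) w) ^+ 2).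
Proof.
set g := fun i => grad (f i) x - grad (f i) w + grad (average f) w.
have -> : grad (average f) x = n%:R^-1 *: \sum_i g i.
  have sumw : \sum_(i < n) grad (average f) w = \sum_i grad (f i) w.
    rewrite sumr_const card_ord -scaler_nat grad_average// scalerA mulfV//.
    by rewrite scale1r.
  by rewrite /g big_split/= sumw sumrB subrK grad_average.
rewrite innerZl inner_suml -/g.
set A := enorm _ ^+ 2.
transitivity (n%:R^-1 * \sum_i ((eta ^+ 2 * enorm (g i) ^+ 2
    - 2 * eta * inner (g i) (x - xs)) + A)).
  congr (_ * _); apply: eq_bigr => i _.
  rewrite -/(g i) addrAC /A; move: (x - xs) (g i) => y v.
  by rewrite !enorm_sqr !innerE (innerC v y); ring.
rewrite average_shift// sumrB -!mulr_sumr; ring.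
Qed.

Lemma potential_contraction s :
  lsvrg_mean_step f eta p (potential f eta p xs) s
    <= (1 - Num.min (mu * eta) (p / 2)) * potential f eta p xs s.
Proof.
set rho := Num.min _ _.
set K : R := 4 * eta ^+ 2 / (p * n%:R).
have potE t : potential f eta p xs t =
    enorm (iterate t - xs) ^+ 2 + K * grad_dist (reference t) by [].
rewrite /lsvrg_mean_step; under eq_bigr do rewrite !potE/=.
rewrite potE; move: (iterate s) (reference s) => x w.
(* The coin affects only the new reference point, hence only the second term of the potential. *)
have mix (y a b : R) :
  p * (y + K * a) + (1 - p) * (y + K * b) = y + K * (p * a + (1 - p) * b) by ring.
under eq_bigr do rewrite mix.
rewrite average_shift// lsvrg_iterate_mean.
have eta_gt0 : 0 < eta by rewrite invr_gt0 mulr_gt0.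
have Leta : 6 * L * eta = 1 by rewrite mulfV// gt_eqF// mulr_gt0.
have sq := lsvrg_direction_sqr_le x w.
have dx := grad_dist_le x.
have := f_sc x xs; rewrite -[xs - x]opprB innerNr.
have -> : enorm (- (x - xs)) ^+ 2 = enorm (x - xs) ^+ 2.
  by rewrite !enorm_sqr innerNl innerNr opprK.
have A0 : 0 <= enorm (x - xs) ^+ 2 by exact: sqr_ge0.
have w0 : 0 <= grad_dist w by apply: sumr_ge0 => i _; exact: sqr_ge0.
(* The weight [1 / p] in the potential cancels the probability of a refresh, so the term created at
   [x] does not depend on [p]. *)
have Kp : K * p = 4 * eta ^+ 2 * n%:R^-1.
  by rewrite /K; field; rewrite n_neq0 gt_eqF.
have split_K a b : K * (p * a + (1 - p) * b) =
    4 * eta ^+ 2 * (n%:R^-1 * a) + (1 - p) * (K * b).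
  by rewrite mulrDr mulrA Kp; ring.
rewrite split_K => sc.
apply: (descent_arith (mu := mu) (b := n%:R^-1 * grad_dist w)
  eta_gt0 Leta A0 _ _ _ _ sq dx).
- have p_ge0 := ltW p_gt0.
  by rewrite mulr_ge0// divr_ge0// mulr_ge0// sqr_ge0.
- by rewrite mulrA [p * K]mulrC Kp -[LHS]mulrA.
- by rewrite ge_min lexx.
- by rewrite ge_min lexx orbT.
- by rewrite /delta; lra.
Qed.

End Contraction.

(** * From independent draws to expectations of the process *)

Section Law.
Context {R : realType} {n d : nat} {disp : measure_display}.
Context {T : measurableType disp} (P : probability T R).
Variables (f : 'I_n -> 'rV[R]_d -> R) (eta p : R) (x0 : 'rV[R]_d).
Variables (idx : nat -> T -> 'I_n) (coin : nat -> T -> bool).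
Hypothesis draws : lsvrg_draws P p idx coin.

Let state k w := lsvrg f eta x0 (fun j => idx j w) (fun j => coin j w) k.
Implicit Types (F : lsvrg_state (R := R) (d := d) -> R).

(** The state depends on finitely many draws with finite range, so the preimage of an arbitrary set
    is a finite union of events; the induction splits on the last index and coin. *)
Lemma measurable_lsvrg k : events_of (state k) `<=` measurable.
Proof.
elim: k => [|k IH] _ [Y _ <-].
  by have := preimage_cst (lsvrg_init (n := n) x0) Y => /= ->; case: ifP.
pose Z a := Y \o lsvrg_step f eta a.1 a.2 : set lsvrg_state.
have -> : state k.+1 @^-1` Y = \bigcup_(a in [set: 'I_n * bool])
    (idx k @^-1` [set a.1] `&` coin k @^-1` [set a.2] `&` state k @^-1` Z a).
  apply/seteqP; split => w /=; first by exists (idx k w, coin k w).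
  by move=> [[i b] _ [[/= <- <-]]].
apply: fin_bigcup_measurable => [|a _]; first exact: finite_finset.
apply: measurableI; last by apply: IH; exists (Z a).
apply: measurableI.
  by apply: (idx_measurable draws (k := k)); exists [set a.1].
by apply: (coin_measurable draws (k := k)); exists [set a.2].
Qed.

Lemma measurable_fun_lsvrg k F : measurable_fun setT (F \o state k).
Proof.
move=> _ Y _; rewrite setTI; apply: (@measurable_lsvrg k).
by exists (F @^-1` Y).
Qed.

Definition draw_time (j : nat + nat) : nat :=
  match j with inl k => k | inr k => k end.

Lemma measurable_draw_events j : draw_events idx coin j `<=` measurable.
Proof.
case: j => k; [exact: (idx_measurable draws) | exact: (coin_measurable draws)].
Qed.

Lemma measurable_draws (s : seq (nat + nat)) (B : nat + nat -> set T) :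
  (forall j, j \in s -> draw_events idx coin j (B j)) ->
  measurable (\bigcap_(j in [set` s]) B j).
Proof.
move=> sB; apply: fin_bigcap_measurable => [|j /= js]; first exact: finite_seq.
by apply: measurable_draw_events; exact: sB.
Qed.

Let weight (b : bool) := if b then p else 1 - p.

Lemma coin_prob k b : P (coin k @^-1` [set b]) = (weight b)%:E.
Proof.
case: b; first exact: (coin_bernoulli draws).
have -> : coin k @^-1` [set false] = ~` (coin k @^-1` [set true]).
  by apply/seteqP; split=> w /=; case: (coin k w).
rewrite probability_setC ?(coin_bernoulli draws)//.
by apply: (coin_measurable draws (k := k)); exists [set true].
Qed.

Lemma lsvrg_mean_stepE k F (t : lsvrg_state (R := R) (d := d)) :
  lsvrg_mean f eta p k.+1 F t =
  \sum_(a : 'I_n * bool) (n%:R^-1 * weight a.2) *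
     lsvrg_mean f eta p k (F \o lsvrg_step f eta a.1 a.2) t.
Proof.
have E : lsvrg_mean_step f eta p F = fun u => \sum_(a : 'I_n * bool)
    (n%:R^-1 * weight a.2) * (F \o lsvrg_step f eta a.1 a.2) u.
  apply/funext => u; rewrite /lsvrg_mean_step mulr_sumr.
  rewrite -(pair_bigA _ (fun i b => n%:R^-1 * weight b * F (lsvrg_step f eta i b u))) /=.
  by apply: eq_bigr => i _; rewrite big_bool/=; ring.
rewrite /= E lsvrg_mean_sum; apply: eq_bigr => a _; exact: lsvrg_meanZ.
Qed.

(* The events [B j] only involve draws made at time [k] or later, which is what
   lets the induction peel off the last iteration. *)
Lemma integral_lsvrg k F (s : seq (nat + nat)) (B : nat + nat -> set T) :
  uniq s -> (forall j, j \in s -> (k <= draw_time j)%N) ->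
  (forall j, j \in s -> draw_events idx coin j (B j)) ->
  (\int[P]_(w in \bigcap_(j in [set` s]) B j) (F (state k w))%:E =
   (lsvrg_mean f eta p k F (lsvrg_init (n := n) x0))%:E
     * P (\bigcap_(j in [set` s]) B j))%E.
Proof.
elim: k F s B => [|k IH] F s B us sk sB.
  exact: (integral_cst P (measurable_draws sB) (F (lsvrg_init x0))%:E).
have inl_s : inl k \notin s by apply/negP => /sk /=; rewrite ltnn.
have inr_s : inr k \notin s by apply/negP => /sk /=; rewrite ltnn.
(* The two draws of iteration [k] join the family, with values prescribed by [a]. All times are then
   at least [k], as the induction hypothesis demands. *)
pose s' : seq (nat + nat) := [:: inl k, inr k & s].
pose B' (a : 'I_n * bool) j := if j == inl k then idx k @^-1` [set a.1]
  else if j == inr k then coin k @^-1` [set a.2] else B j.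
have us' : uniq s' by rewrite /= inE negb_or inl_s inr_s us.
have B's a j : j \in s -> B' a j = B j.
  by move=> js; rewrite /B' !ifN//; apply: contraTneq js => ->.
have s'B a j : j \in s' -> draw_events idx coin j (B' a j).
  rewrite !inE => /or3P[/eqP->|/eqP->|js].
  - by rewrite /B' eqxx; exists [set a.1].
  - by rewrite /B' /= eqxx; exists [set a.2].
  - by rewrite B's//; exact: sB.
have s'k j : j \in s' -> (k <= draw_time j)%N.
  by rewrite !inE => /or3P[/eqP->|/eqP->|/sk/ltnW].
set D := \bigcap_(j in [set` s]) B j.
pose D' a := \bigcap_(j in [set` s']) B' a j.
have D'E a : D' a = [set w | [/\ idx k w = a.1, coin k w = a.2 & D w]].
  apply/seteqP; split => w /=.
    move=> Dw; split.
    - by have := Dw (inl k); rewrite /B' eqxx; apply; rewrite /= inE eqxx.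
    - by have := Dw (inr k); rewrite /B' /= eqxx; apply; rewrite /= !inE eqxx.
    - by move=> j js; rewrite -(B's a)//; apply: Dw; rewrite /= !inE js !orbT.
  move=> [ka kb Dw] j; rewrite /= !inE => /or3P[/eqP->|/eqP->|js].
  - by rewrite /B' eqxx.
  - by rewrite /B' /= eqxx.
  - by rewrite B's//; exact: Dw.
have PD' a : P (D' a) = ((n%:R^-1 * weight a.2)%:E * P D)%E.
  rewrite (draws_independent draws us' (s'B a)) !big_cons.
  rewrite (draws_independent draws us sB) muleA /B' eqxx /= eqxx.
  rewrite (idx_uniform draws) coin_prob -EFinM; congr (_ * _)%E.
  by apply: eq_big_seq => j js; rewrite -/(B' a j) B's.
(* The outcomes of the two draws partition [D]; on each piece the last iteration is a fixed map. *)
have DE : D = \big[setU/set0]_(a : 'I_n * bool) D' a.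
  rewrite -bigcup_seq; apply/seteqP; split => w /=.
    move=> Dw; exists (idx k w, coin k w); first exact: mem_index_enum.
    by rewrite D'E.
  by move=> [a _]; rewrite D'E => -[].
have mD : measurable D by exact: (measurable_draws sB).
rewrite {1}DE integral_bigsetU_EFin; last 4 first.
- by move=> a; exact: (measurable_draws (s'B a)).
- exact: index_enum_uniq.
- move=> a b _ _ [w []]; rewrite !D'E /= => -[ia ca _] [ib cb _].
  by rewrite [a]surjective_pairing [b]surjective_pairing -ia -ca ib cb.
- rewrite -DE; apply/measurable_EFinP.
  exact/measurable_funTS/measurable_fun_lsvrg.
rewrite lsvrg_mean_stepE -[P D]fineK ?fin_num_measure// -EFinM mulr_suml -sumEFin.
apply: eq_bigr => a _.
transitivity (\int[P]_(w in D' a)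
    ((F \o lsvrg_step f eta a.1 a.2) (state k w))%:E)%E.
  apply: eq_integral => w; rewrite inE D'E => -[/= ia ca _].
  by rewrite /state /= ia ca.
rewrite (IH _ s' (B' a) us' s'k (s'B a)) -/(D' a) PD'.
rewrite -[P D]fineK ?fin_num_measure// -!EFinM.
by congr EFin; ring.
Qed.

Lemma expectation_lsvrg k F :
  ('E_P[F \o state k] =
   (lsvrg_mean f eta p k F (lsvrg_init (n := n) x0))%:E)%E.
Proof.
rewrite unlock.
have := @integral_lsvrg k F [::] (fun=> setT) isT; rewrite set_nil bigcap_set0.
by rewrite probability_setT mule1 => ->.
Qed.

(** The increment involves two successive states, so it is integrated directly, as [2] plus [n]
    times the indicator of a refresh. *)
Lemma expectation_calls_diff k :
  ('E_P[(fun w => (calls (state k.+1 w))%:R : R) \- (fun w => (calls (state k w))%:R)]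
   = (2 + p * n%:R)%:E)%E.
Proof.
rewrite unlock.
have mA : measurable (coin k @^-1` [set true]).
  by apply: (coin_measurable draws (k := k)); exists [set true].
transitivity (\int[P]_w (2%:E + n%:R%:E * (\1_(coin k @^-1` [set true]) w)%:E))%E.
  apply: eq_integral => w _; rewrite -EFinM -EFinD; congr EFin.
  rewrite /state /= !natrD indicE.
  have -> : (w \in coin k @^-1` [set true]) = coin k w.
    by apply/idP/idP; rewrite inE.
  by case: (coin k w); rewrite ?mulr1 ?mulr0 ?addr0; ring.
have mI : measurable_fun setT (EFin \o \1_(coin k @^-1` [set true]) : T -> \bar R).
  exact/measurable_EFinP/measurable_indic.
rewrite ge0_integralD//; last exact: measurable_funeM.
have -> : (\int[P]_(w in [set: T]) 2%:E = 2%:E)%E.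
  transitivity (2%:E * P setT)%E; last by rewrite probability_setT mule1.
  exact: (integral_cst P measurableT 2%:E).
rewrite ge0_integralZl_EFin//.
rewrite (integral_indic P measurableT mA) setIT.
have /= -> := coin_bernoulli draws k.
by rewrite -EFinM -EFinD mulrC.
Qed.

End Law.

(** * Iteration counts and total complexity *)

Lemma first_reaches_exists {disp : measure_display} {T : measurableType disp}
    {R : realType} (P : probability T R) (X : nat -> T -> R) (t : R) (K : nat) :
  ('E_P[X K] <= t%:E)%E -> exists2 k, first_reaches P X t k & (k <= K)%N.
Proof.
move=> XK; have ex : exists k, ('E_P[X k] <= t%:E)%E by exists K.
exists (ex_minn ex); case: ex_minnP => k Xk kmin; last exact: kmin.
by split=> // j jk; rewrite ltNge; apply: contraL jk => /kmin; rewrite -leqNgt.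
Qed.

(** Follows from [1 - rho <= expR (- rho)]. *)
Lemma geometric_le_eps {R : realType} (rho eps : R) (k : nat) :
  rho <= 1 -> 0 < eps -> ln (1 / eps) <= k%:R * rho -> (1 - rho) ^+ k <= eps.
Proof.
move=> rho1 eps0 hk; apply: (@le_trans _ _ (expR (- rho) ^+ k)).
  by rewrite lerXn2r ?nnegrE ?expR_ge0 ?subr_ge0// expR_ge1Dx.
rewrite -expRM_natl -[leRHS]lnK ?posrE// ler_expR.
by move: hk; rewrite div1r lnV ?posrE// mulrN lerNl.
Qed.

(** Keeps the logarithm away from zero, so that additive costs can be absorbed into multiples of it.
    The proof uses [expR (- (1 / 2)) >= 1 / 2]. *)
Lemma half_le_ln {R : realType} (eps : R) : 0 < eps <= 1 / 2 ->
  1 / 2 <= ln (1 / eps).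
Proof.
move=> /andP[eps0 eps2]; rewrite -ler_expR lnK ?posrE ?divr_gt0//.
apply: (@le_trans _ _ 2); last by rewrite ler_pdivlMr//; lra.
have h := @expR_ge1Dx R (- (1 / 2)); rewrite expRN in h.
have e0 := expR_gt0 (1 / 2 : R).
rewrite -[expR _]invrK invf_ple ?posrE ?invr_gt0//; lra.
Qed.

Theorem mainTheorem3 (R : realType) :
  exists (C1 C2 : R) (C3 : R -> R),
  forall (n d : nat) (f : 'I_n -> 'rV[R]_d -> R) (L mu p : R)
    (x0 xs : 'rV[R]_d)
    (disp : measure_display) (T : measurableType disp) (P : probability T R)
    (idx : nat -> T -> 'I_n) (coin : nat -> T -> bool),
  (0 < n)%N -> (0 < d)%N ->
  0 < L -> 0 < mu -> 0 < p <= 1 ->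
  (forall i x, differentiable (f i) x) ->
  (forall i, convex_diff (f i)) ->
  (forall i, smooth L (f i)) ->
  strongly_convex mu (average f) ->
  (forall y, average f xs <= average f y) ->
  lsvrg_draws P p idx coin ->
  let eta := (6 * L)^-1 in
  let state (k : nat) (w : T) :=
    lsvrg f eta x0 (fun j => idx j w) (fun j => coin j w) k in
  let Phi (k : nat) (w : T) := potential f eta p xs (state k w) in
  let Phi0 := potential f eta p xs (lsvrg_init (n := n) x0) in
  let total_calls (k : nat) (w : T) : R := (calls (state k w))%:R in
  let complexity_at_most (eps bound : R) :=
    exists k, first_reaches P Phi (eps * Phi0) k /\
      ('E_P[total_calls k] <= bound%:E)%E in
  (forall k, ('E_P[total_calls k.+1 \- total_calls k]
              <= (C1 * (1 + p * n%:R))%:E)%E) /\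
  (forall eps, 0 < eps <= 1 / 2 ->
    complexity_at_most eps
      (C2 * ((p^-1 + n%:R + L / mu + L * p * n%:R / mu) * ln (1 / eps)))) /\
  (forall c, 0 < c ->
    Num.min (c / n%:R) (c * mu / L) <= p <= Num.max (c / n%:R) (c * mu / L) ->
    forall eps, 0 < eps <= 1 / 2 ->
    complexity_at_most eps (C3 c * ((n%:R + L / mu) * ln (1 / eps)))).
Proof.
(* The [12] is the [6] of [6 * (L / mu)] in the bound on [1 / rho] times the two calls per
   iteration. In the last constant, [c^-1] pays for [1 / p] and [c] for [L * p * n / mu]. *)
exists 2, 12, (fun c => 12 * (1 + c^-1 + c)).
move=> n d f L mu p x0 xs disp T P idx coin n0 d0 L0 mu0 /andP[p0 p1].
move=> df fc fs sc xsmin draws eta state Phi Phi0 total_calls complexity_at_most.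
have n1 : 1 <= n%:R :> R by rewrite ler1n.
have p_ge0 := ltW p0.
have p01 : 0 <= p <= 1 by rewrite p_ge0.
pose rate := p^-1 + n%:R + L / mu + L * p * n%:R / mu.
have bound_rate eps : 0 < eps <= 1 / 2 ->
    complexity_at_most eps (12 * (rate * ln (1 / eps))).
  move=> eps12; have ln_ge := half_le_ln eps12; have /andP[eps0 _] := eps12.
  set l := ln (1 / eps) in ln_ge *.
  pose rho := Num.min (mu * eta) (p / 2).
  have eta0 : 0 < eta by rewrite invr_gt0 mulr_gt0.
  have rho0 : 0 < rho by rewrite lt_min mulr_gt0// divr_gt0.
  have rho1 : rho <= 1 by rewrite ge_min; apply/orP; right; lra.
  have rhoV : rho^-1 <= 6 * (L / mu) + 2 * p^-1.
    have h1 : 0 < L / mu by rewrite divr_gt0.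
    have h2 : 0 < p^-1 by rewrite invr_gt0.
    rewrite /rho; case: (leP (mu * eta) (p / 2)) => _.
      by rewrite invfM invrK mulrC -mulrA; lra.
    by rewrite invf_div; lra.
  (* Just above [l / rho], which gives the accuracy, and at most [l / rho + 1], which gives the
     cost. *)
  pose K := (Num.trunc (l / rho)).+1.
  have l_ge0 : 0 <= l / rho by rewrite divr_ge0 ?ltW//; lra.
  have Kl : l <= K%:R * rho by rewrite -ler_pdivrMr// ltW// truncnS_gt.
  have lK : K%:R <= l / rho + 1.
    by rewrite /K -natr1 lerD2r; have /andP[] := truncn_itv l_ge0.
  have Phi0_ge0 : 0 <= Phi0.
    rewrite /Phi0 /potential addr_ge0 ?sqr_ge0// mulr_ge0//.
      by rewrite divr_ge0// mulr_ge0// sqr_ge0.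
    by apply: sumr_ge0 => i _; rewrite sqr_ge0.
  have PhiK : ('E_P[Phi K] <= (eps * Phi0)%:E)%E.
    have -> : Phi K = potential f eta p xs \o state K by [].
    rewrite (expectation_lsvrg f eta x0 draws) lee_fin.
    apply: (@le_trans _ _ ((1 - rho) ^+ K * Phi0)).
      apply: lsvrg_mean_geometric => //; first by rewrite subr_ge0.
      by move=> t; exact: potential_contraction.
    by rewrite ler_wpM2r//; exact: geometric_le_eps.
  (* The first hitting index may be smaller than [K]; the expected cost grows with the index, so the
     bound through [K] still applies. *)
  have [k kfirst kK] := first_reaches_exists PhiK.
  exists k; split => //.
  have -> : total_calls k = (fun t => (calls t)%:R) \o state k by [].
  rewrite (expectation_lsvrg f eta x0 draws) lee_fin lsvrg_mean_calls//=.
  have kl : k%:R <= l / rho + 1 by rewrite (le_trans _ lK)// ler_nat.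
  have pn0 : 0 <= p * n%:R by rewrite mulr_ge0// ltW.
  have pn : p * n%:R <= n%:R by rewrite ler_piMl.
  apply: (@le_trans _ _ (n%:R + (l * (6 * (L / mu) + 2 * p^-1) + 1) * (2 + p * n%:R))).
    rewrite lerD2l ler_wpM2r//; first by lra.
    by rewrite (le_trans kl)// lerD2r ler_wpM2l//; lra.
  (* What remains must cover the initial full gradient and the rounded-up iteration,
     [n + 2 + p * n <= 4 * n]; since [l >= 1 / 2], the term [10 * n * l] does. *)
  have -> : 12 * (rate * l) = l * (6 * (L / mu) + 2 * p^-1) * (2 + p * n%:R)
     + (8 * p^-1 + 10 * n%:R + 6 * (L * p * n%:R / mu)) * l.
    by rewrite /rate; field; rewrite !gt_eqF.
  have q0 : 0 <= L * p * n%:R / mu.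
    by rewrite divr_ge0 ?mulr_ge0// ltW.
  have p'0 : 0 <= p^-1 by rewrite invr_ge0 ltW.
  have h1 : 0 <= (8 * p^-1 + 6 * (L * p * n%:R / mu)) * l.
    by rewrite mulr_ge0//; lra.
  have h2 : n%:R * (1 / 2) <= n%:R * l by rewrite ler_wpM2l//; lra.
  lra.
split; [|split => //].
  move=> k; rewrite (expectation_calls_diff f eta x0 draws) lee_fin.
  have : 0 <= p * n%:R by rewrite mulr_ge0// ltW.
  lra.
move=> c c0 /andP[cp pc] eps eps12.
have [k [kfirst kcalls]] := bound_rate eps eps12; exists k; split => //.
apply: le_trans kcalls _; rewrite lee_fin -!mulrA ler_pM2l// !mulrA.
apply: ler_wpM2r; first by have := half_le_ln eps12; lra.
have n_gt0 : 0 < n%:R :> R by rewrite ltr0n.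
have b_gt0 : 0 < L / mu by rewrite divr_gt0.
(* The lower end of the range: [p] is at least one of the two quantities, so [1 / p] is at most
   [n / c] or [L / (c * mu)]. *)
have pV : p^-1 <= c^-1 * (n%:R + L / mu).
  have cV : 0 < c^-1 by rewrite invr_gt0.
  move: cp; rewrite ge_min => /orP[] cp.
    apply: (@le_trans _ _ (c^-1 * n%:R)); last by rewrite ler_pM2l// lerDl ltW.
    by rewrite -[leRHS]invrK invfM invrK lef_pV2 ?posrE ?divr_gt0.
  apply: (@le_trans _ _ (c^-1 * (L / mu))).
    rewrite -[leRHS]invrK lef_pV2 ?posrE ?invr_gt0 ?mulr_gt0 ?invr_gt0//.
    by rewrite !invfM !invrK [L^-1 * _]mulrC mulrA.
  by rewrite ler_pM2l// lerDr ltW.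
(* The upper end: either [p * n <= c] or [p * (L / mu) <= c], and the remaining factor is [L / mu]
   or [n]. *)
have pab : L * p * n%:R / mu <= c * (n%:R + L / mu).
  have -> : L * p * n%:R / mu = p * n%:R * (L / mu) by ring.
  move: pc; rewrite le_max => /orP[] pc.
    have h : p * n%:R <= c by rewrite -ler_pdivlMr.
    apply: (@le_trans _ _ (c * (L / mu))); first by rewrite ler_pM2r.
    by rewrite ler_pM2l// lerDr ltW.
  have h : p * (L / mu) <= c.
    rewrite -ler_pdivlMr// (le_trans pc)// le_eqVlt; apply/orP; left.
    by rewrite invf_div mulrA.
  rewrite mulrAC; apply: (@le_trans _ _ (c * n%:R)); first by rewrite ler_pM2r.
  by rewrite ler_pM2l// lerDl ltW.
rewrite /rate; lra.
Qed.
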